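(* The function $\gamma^{\mathrm{PF}}$ (the vector of logarithms of the proportionally fair allocations) satisfies, for all $x\in\mathbb{R}_+^{\mathcal{R}}$, $$\gamma^{\mathrm{PF}}(x)\in\partial\delta_K^*(x),$$ where $\partial\delta_K^*(x)$ denotes the subgradient of the convex function $\delta_K^*$ at $x$.
   Context: $\mathcal{R}$ is a finite set (of user types). The capacity set $\mathcal{C}\subset\mathbb{R}_+^{\mathcal{R}}$ is convex and nonincreasing (if $\lambda,\lambda'\in\mathbb{R}_+^{\mathcal{R}}$, $\lambda_r\le\lambda'_r$ for all $r\in\mathcal{R}$ and $\lambda'\in\mathcal{C}$, then $\lambda\in\mathcal{C}$). The set $K\subset\mathbb{R}^{\mathcal{R}}$ is defined by $\gamma\in K\Leftrightarrow(e^{\gamma_r})_{r\in\mathcal{R}}\in\mathcal{C}$; $\delta_K$ is the function equal to $0$ on $K$ and $+\infty$ outside $K$; and $\delta_K^*(x)=\sup_{\gamma\in\mathbb{R}^{\mathcal{R}}}(\langle\gamma,x\rangle-\delta_K(\gamma))$ is its Fenchel–Legendre convex conjugate. The proportionally fair allocation $\lambda^{\mathrm{PF}}(x)$ is a maximizer of $\sum_{r\in\mathcal{R}}x_r\log(\lambda_r)$ over $\lambda\in\mathcal{C}$, and $\gamma^{\mathrm{PF}}(x)=(\log\lambda_r^{\mathrm{PF}}(x))_{r\in\mathcal{R}}$, so that $\gamma^{\mathrm{PF}}(x)\in\arg\sup_{\gamma\in\mathbb{R}^{\mathcal{R}}}(\langle\gamma,x\rangle-\delta_K(\gamma))$. The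 subgradient $\partial J(x)$ of a convex function $J$ on $\mathbb{R}^n$ at $x\in\mathbb{R}^n$ is the set of all vectors $h$ such that $J(x)+\langle h,y-x\rangle\le J(y)$ for all $y\in\mathbb{R}^n$. *)

(* Defs.v *)
(* MathComp-Analysis. *)
From mathcomp Require Import all_boot all_order all_algebra.
From mathcomp Require Import all_classical all_reals all_analysis.

Set Implicit Arguments.
Unset Strict Implicit.
Unset Printing Implicit Defensive.

Import Order.TTheory GRing.Theory Num.Theory.

Local Open Scope classical_set_scope.
Local Open Scope ring_scope.
Local Open Scope ereal_scope.

Section Defs.
Context {R : realType} {I : finType}.

Definition orthant : set (I -> R) := [set x | forall r, (0 <= x r)%R].

(* [R^o] instead of [R] only serves to equip [I -> R] with the vector space
   structure over [R] required by [convex_set]. *)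
Definition is_capacity_set (C : set (I -> R^o)) : Prop :=
  [/\ C `<=` orthant,
      convex_set C &
      forall l l' : I -> R, orthant l -> orthant l' ->
        (forall r, (l r <= l' r)%R) -> C l' -> C l].

Definition log_capacity (C : set (I -> R)) : set (I -> R) :=
  [set g | C (fun r => expR (g r))].

Definition indicator_fct (K : set (I -> R)) (g : I -> R) : \bar R :=
  if g \in K then 0 else +oo.

Definition conjugate (f : (I -> R) -> \bar R) (x : I -> R) : \bar R :=
  ereal_sup [set (\sum_r g r * x r)%R%:E - f g | g in [set: I -> R]].

(* [lne] is the extended logarithm, with log 0 = -oo; since 0 * -oo = 0, the
   coordinates r with x r = 0 do not contribute. *)
Definition pf_objective (x l : I -> R) : \bar R :=
  \sum_r (x r)%:E * lne (l r)%:E.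

Definition is_pf_allocation (C : set (I -> R)) (x l : I -> R) : Prop :=
  C l /\ forall l', C l' -> pf_objective x l' <= pf_objective x l.

(* On the boundary of the orthant, l r = 0 is possible when x r = 0 (and forced
   if C = {l | l1 + l2 <= 1} and x = (1, 0)), hence the extended values. *)
Definition log_vector (l : I -> R) : I -> \bar R := fun r => lne (l r)%:E.

(* The vectors h may have infinite entries, so as to accommodate [log_vector];
   0 * -oo = 0 and -oo + +oo = -oo.  On real vectors this is the usual
   subgradient, see [subgradient_EFin]. *)
Definition subgradient (J : (I -> R) -> \bar R) (x : I -> R) :
    set (I -> \bar R) :=
  [set h | forall y : I -> R, J x + \sum_r h r * (y r - x r)%:E <= J y].

Lemma subgradient_EFin (J : (I -> R) -> \bar R) (x h : I -> R) :
  subgradient J x (fun r => (h r)%:E) <->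
  forall y : I -> R, J x + (\sum_r h r * (y r - x r))%R%:E <= J y.
Proof.
have E y : \sum_r (h r)%:E * (y r - x r)%:E =
    (\sum_r h r * (y r - x r))%R%:E.
  by rewrite -sumEFin; apply: eq_bigr => r _; rewrite EFinM.
by split=> H y; have := H y; rewrite E.
Qed.

End Defs.

(* Main.v *)
(* Off the boundary of the orthant this is Fenchel's equality case: [gammaPF x]
   attains the supremum defining the conjugate at [x], and is a competitor at
   every [y].  If some [lambdaPF x r] vanishes, [gammaPF x] is no longer a point
   of [K]; optimality forces [x r = 0], so the inequality is trivial when
   [y r > 0] (the left side is -oo) and when [y r < 0] (the conjugate is +oo at
   [y], as [K] is nonincreasing).  In the remaining case [y r = 0] the
   allocation is mixed with a small multiple of a positive point of [C]. *)
Require Import Defs.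
From mathcomp Require Import all_boot all_order all_algebra.
From mathcomp Require Import all_classical all_reals all_analysis.
From mathcomp Require Import lra.

Import Order.TTheory GRing.Theory Num.Theory.

Local Open Scope classical_set_scope.
Local Open Scope ring_scope.

Lemma esum_eqNy (R : realType) (I : finType) (F : I -> \bar R) (r : I) :
  F r = -oo%E -> (\sum_i F i = -oo)%E.
Proof. by move=> Fr; rewrite (bigD1 r)//= Fr addNye. Qed.

Lemma lneE (R : realType) (a : R) :
  0 <= a -> lne a%:E = if a == 0 then -oo%E else (ln a)%:E.
Proof. by move=> a0; rewrite /lne le_eqVlt ltNge a0 orbF. Qed.

Section ConjugateIndicator.
Context {R : realType} {I : finType}.
Implicit Types (K : set (I -> R)) (g x y l : I -> R).

Lemma le_conjugate_indicator K g x : K g ->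
  ((\sum_r g r * x r)%:E <= conjugate (indicator_fct K) x)%E.
Proof.
move=> Kg; apply: ereal_sup_ubound; exists g => //.
by rewrite /indicator_fct mem_set// sube0.
Qed.

Lemma conjugate_indicator_le K x (M : \bar R) :
  (forall g, K g -> ((\sum_r g r * x r)%:E <= M)%E) ->
  (conjugate (indicator_fct K) x <= M)%E.
Proof.
move=> KM; apply: ge_ereal_sup => _ [g _ <-]; rewrite /indicator_fct.
have [/set_mem Kg|_] := boolP (g \in K); first by rewrite sube0 KM.
by rewrite /= leNye.
Qed.

Lemma pf_objective_expR x g :
  pf_objective x (fun r => expR (g r)) = (\sum_r g r * x r)%:E.
Proof.
rewrite /pf_objective -sumEFin; apply: eq_bigr => r _.
by rewrite lne_EFin ?expR_gt0// expRK -EFinM mulrC.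
Qed.

(** Where [l r = 0], the extended logarithm is [-oo] and the real [ln] only has a default value; the
    factor [z r = 0] cancels both. *)
Lemma sum_log_vector l (z : I -> R) : orthant l ->
  (forall r, l r = 0 -> z r = 0) ->
  (\sum_r log_vector l r * (z r)%:E)%E = (\sum_r ln (l r) * z r)%:E.
Proof.
move=> l0 lz; rewrite -sumEFin; apply: eq_bigr => r _.
rewrite /log_vector lneE//; case: eqP => [/lz ->|_]; last by rewrite EFinM.
by rewrite mule0 mulr0.
Qed.

Section Capacity.
Context {C : set (I -> R^o)} (hC : is_capacity_set C).
Local Notation J := (conjugate (indicator_fct (log_capacity C))).

Lemma log_capacity_le g g' : log_capacity C g -> (forall r, g' r <= g r) ->
  log_capacity C g'.
Proof.
case: hC => _ _ Cdown Kg g'g; apply: Cdown Kg => r /=; rewrite ?expR_ge0//.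
by rewrite ler_expR.
Qed.

(** Lowering coordinate [r] of [g] by [t] stays in the log-capacity set and adds [- t * y r], which
    is unbounded in [t]. *)
Lemma conjugate_log_capacity_neg g y r : log_capacity C g -> y r < 0 ->
  J y = +oo%E.
Proof.
move=> Kg yr; apply/eqyP => A A0.
(* With this [t], the gain [- t * y r] offsets the pairing of [g] with [y] and still leaves at least
   [A]. *)
pose t := (`|A| + `|\sum_i g i * y i|) / - y r.
have t0 : 0 <= t by rewrite divr_ge0 ?addr_ge0// oppr_ge0 ltW.
pose g' i := g i - (if i == r then t else 0).
have Kg' : log_capacity C g'.
  by apply: log_capacity_le Kg _ => i; rewrite /g'; case: ifP; lra.
apply: le_trans (le_conjugate_indicator _ _ y Kg'); rewrite lee_fin.
have -> : \sum_i g' i * y i = \sum_i g i * y i - t * y r.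
  under eq_bigr do rewrite mulrBl; rewrite big_split/= sumrN; congr (_ - _).
  by rewrite (bigD1 r)//= eqxx big1 ?addr0// => i /negbTE ->; rewrite mul0r.
have -> : t * y r = - (`|A| + `|\sum_i g i * y i|).
  by rewrite /t invrN mulrN mulNr divfK// lt_eqF.
have := ler_norm A; have := ler_norm (- \sum_i g i * y i); rewrite normrN; lra.
Qed.

Lemma le_conjugate_log_capacity l g y : C l -> log_capacity C g ->
  orthant y -> (forall r, l r = 0 -> y r = 0) ->
  ((\sum_r ln (l r) * y r)%:E <= J y)%E.
Proof.
case: hC => Corth Cconv _ Cl Kg y0 ly; have l0 := Corth _ Cl.
have Y0 : 0 <= \sum_r y r by apply: sumr_ge0 => r _; exact: y0.
(* Giving [l] the weight [expR (- d)] lowers each relevant logarithm by at most [d], a total loss of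
   at most [d * \sum_r y r <= e]; the [1 +] keeps the denominator positive when [y = 0]. *)
apply/lee_subgt0Pr => e e0; pose d := e / (1 + \sum_r y r).
have d0 : 0 < d by rewrite divr_gt0//; lra.
have p0 : 0 < expR (- d) by exact: expR_gt0.
have p1 : expR (- d) < 1 by rewrite expR_lt1; lra.
pose m r := expR (- d) * l r + (1 - expR (- d)) * expR (g r).
have m0 r : 0 < m r.
  by rewrite ltr_wpDl ?mulr_ge0 ?mulr_gt0 ?expR_gt0 ?(ltW p0) ?subr_gt0.
have Cm : C m.
  have p01 : Itv.spec (@Itv.num_sem R) (Itv.Real `[0%Z, 1%Z]) (expR (- d)).
    by rewrite /= /Itv.num_sem/= in_itv/= num_real !ltW.
  have := Cconv _ _ (Itv.mk p01) (mem_set Cl) (mem_set Kg).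
  by move/set_mem.
have Km : log_capacity C (fun r => ln (m r)).
  rewrite /log_capacity/=; under eq_fun do rewrite lnK ?posrE//.
  exact: Cm.
apply: le_trans (le_conjugate_indicator _ _ y Km).
rewrite -EFinB lee_fin.
apply: (@le_trans _ _ (\sum_r (ln (l r) - d) * y r)).
  under [leRHS]eq_bigr do rewrite mulrBl.
  rewrite big_split/= sumrN -mulr_sumr lerD2l lerN2 /d mulrAC.
  rewrite ler_pdivrMr; last lra.
  rewrite ler_pM2l//; lra.
apply: ler_sum => r _; have [lr|lr] := eqVneq (l r) 0.
  by rewrite ly// !mulr0.
have {}lr : 0 < l r by rewrite lt0r lr l0.
(* Here [ln (l r) - d] is the logarithm of [expR (- d) * l r], the first summand of [m r]. *)
rewrite ler_wpM2r ?y0// -[X in _ - X]opprK opprK -[- d]expRK -lnM ?posrE//.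
rewrite ler_ln ?posrE ?mulr_gt0// mulrC lerDl mulr_ge0 ?expR_ge0//; lra.
Qed.

End Capacity.
End ConjugateIndicator.

(** If [x r > 0], the zero coordinate makes the objective [-oo] at [l], whereas it is finite at the
    positive point [expR (g r)] of [C], against maximality. *)
Lemma pf_allocation_eq0 {R : realType} {I : finType} {C : set (I -> R^o)}
    {x l g : I -> R} : orthant x -> orthant l -> is_pf_allocation C x l ->
  log_capacity C g -> forall r, l r = 0 -> x r = 0.
Proof.
move=> x0 l0 [_ lmax] Kg r lr; apply/eqP; apply: contraT => xr.
have := lmax _ Kg; rewrite pf_objective_expR /pf_objective.
rewrite (@esum_eqNy _ _ _ r)//.
by rewrite lneE// lr eqxx gt0_muleNy// lte_fin lt0r xr x0.
Qed.

Theorem lemma1 (R : realType) (I : finType) (C : set (I -> R^o))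
    (hC : is_capacity_set C)
    (lambdaPF : (I -> R) -> (I -> R))
    (hPF : forall x, orthant x -> is_pf_allocation C x (lambdaPF x)) :
  let gammaPF := fun x => log_vector (lambdaPF x) in
  forall x, orthant x ->
    subgradient (conjugate (indicator_fct (log_capacity C))) x (gammaPF x).
Proof.
move=> /= x x0 y; set l := lambdaPF x; set J := conjugate _.
have [Cl lmax] := hPF x x0; have l0 : orthant l by case: hC => + _ _; apply.
have [[g Kg]|K0] := pselect (exists g, log_capacity C g); last first.
  (* Without positive points in [C] the supremum is [-oo], which absorbs any added term. *)
  suff -> : J x = -oo%E by rewrite addNye leNye.
  apply/eqP; rewrite -leeNy_eq; apply: conjugate_indicator_le => g Kg.
  by case: K0; exists g.
have lx := pf_allocation_eq0 x0 l0 (hPF x x0) Kg.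
have [[r yr]|y0] := pselect (exists r, y r < 0).
  by rewrite [leRHS](conjugate_log_capacity_neg hC _ _ _ Kg yr) leey.
have {}y0 : orthant y.
  by move=> r; rewrite leNgt; apply/negP => ?; apply: y0; exists r.
have [[r [lr yr]]|ly] := pselect (exists r, l r = 0 /\ y r != 0).
  rewrite (@esum_eqNy _ _ _ r) ?addeNy ?leNye// /log_vector lneE//.
  by rewrite lr eqxx lx// subr0 gt0_mulNye// lte_fin lt0r yr y0.
have {}ly r : l r = 0 -> y r = 0.
  by move=> lr; apply/eqP; apply: contraT => yr; case: ly; exists r.
(* Maximality of [l] is tested against the points of [C] of the form [expR (g' r)]. *)
have Jx : (J x <= (\sum_r ln (l r) * x r)%:E)%E.
  apply: conjugate_indicator_le => g' Kg'; rewrite -pf_objective_expR.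
  rewrite (le_trans (lmax _ Kg'))// -sum_log_vector//.
  by rewrite /pf_objective; under eq_bigr do rewrite muleC.
rewrite sum_log_vector//; last by move=> r lr; rewrite lx// ly// subr0.
apply: le_trans (le_conjugate_log_capacity hC _ _ _ Cl Kg y0 ly).
rewrite (le_trans (leeD2r _ Jx))// -EFinD lee_fin -big_split/=.
by apply: ler_sum => r _; rewrite -mulrDr subrKC.
Qed.
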